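(* Let $n\geq 2$ and let $S_{n,n}$ be the double star graph. Then $$\mathrm{QEC}(S_{n,n})=\lambda_2(S_{n,n})=\frac{-(n+2)+\sqrt{(n+2)^2-8}}{2}.$$ Moreover, in the definition of $\mathrm{QEC}(S_{n,n})$, the maximum is attained at the vector $f=\frac{g}{\|g\|}\in\mathbb{R}^{2n}$, where $$g=\begin{pmatrix} y\\ -y\end{pmatrix},\qquad y\in\mathbb{R}^n,\qquad y_i=\begin{cases}\dfrac{n+\sqrt{(n+2)^2-8}}{2}, & i=1,\\[2mm] -1, & 2\leq i\leq n,\end{cases}$$ with the vertices of $S_{n,n}$ labeled $1,\dots,2n$ so that one copy of $K_{1,n-1}$ is induced by $\{1,\dots,n\}$ with center $1$ and the other copy is induced by $\{n+1,\dots,2n\}$ with center $n+1$.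
   Context: For a finite, simple, connected, unweighted graph $G=(V,E)$, the distance matrix $D_G$ is the real symmetric $V\times V$ matrix whose $(v,w)$ entry is the length of a shortest path joining $v$ and $w$ (and $0$ if $v=w$). The eigenvalues of $D_G$, counted with multiplicity, are arranged as $\lambda_1(G)>\lambda_2(G)\geq\cdots\geq\lambda_{|V|}(G)$. Let $C(V)\cong\mathbb{R}^{|V|}$ be the space of real-valued functions on $V$, with canonical inner product $\langle\cdot,\cdot\rangle$ and norm $\|\cdot\|$, and let $e\in C(V)$ be the constant function $1$. For a graph $G$ with at least two vertices, the quadratic embedding constant is $$\mathrm{QEC}(G)=\max\{\langle f,D_Gf\rangle : f\in C(V),\ \langle f,f\rangle=1,\ \langle e,f\rangle=0\}.$$ $K_{1,n-1}$ is the star graph on $n$ vertices. The double star graph $S_{m,n}$ is the tree obtained by adding an edge between the center vertices of the star graphs $K_{1,m-1}$ and $K_{1,n-1}$ (taken on disjoint vertex sets). For $K_{1,1}$, either vertex may be designated as the center. *)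

(* Defs.v *)
From HB Require Import structures.
From mathcomp Require Import all_boot all_order all_algebra.
From mathcomp Require Import classical_sets reals.

Set Implicit Arguments.
Unset Strict Implicit.
Unset Printing Implicit Defensive.
Import Order.TTheory GRing.Theory Num.Theory.
Local Open Scope ring_scope.

Record connected_graph (V : finType) := ConnectedGraph {
  adj : rel V;
  adj_sym : symmetric adj;
  adj_irr : irreflexive adj;
  adj_connected : forall v w, connect adj v w
}.

Section Distance.
Variables (V : finType) (G : connected_graph V).

Definition has_path_of_length (v w : V) (k : nat) : bool :=
  [exists p : k.-tuple V,
    [&& path (adj G) v p, uniq (v :: p) & last v p == w]].

Lemma ex_path_of_length (v w : V) : exists k, has_path_of_length v w k.
Proof.
have /connectP [p pP ->] := adj_connected G v w.
case/shortenP: pP => q pq uq _; exists (size q).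
by apply/existsP; exists (in_tuple q); rewrite pq uq eqxx.
Qed.

Definition dist (v w : V) : nat := ex_minn (ex_path_of_length v w).

End Distance.

Section FunctionSpace.
Variables (R : realType) (V : finType).
Implicit Types f g : {ffun V -> R}.

Definition inner f g : R := \sum_v f v * g v.

Definition norm2 f : R := Num.sqrt (inner f f).

Definition const1 : {ffun V -> R} := [ffun=> 1].

End FunctionSpace.

Arguments const1 {R V}.

(* The eigenvalues of A with algebraic multiplicity, in nonincreasing order.
   The defining property determines the list, which exists as soon as the
   characteristic polynomial of A splits over R, hence for A symmetric;
   otherwise the value is [::]. *)
Definition eigenvalues (R : realType) (n : nat) (A : 'M[R]_n) : seq R :=
  xget [::] [set s : seq R | sorted >=%R s /\
                             char_poly A = \prod_(x <- s) ('X - x%:P)]%classic.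

Section DistanceMatrix.
Variables (R : realType) (V : finType) (G : connected_graph V).

(* The V x V matrix D_G, its rows and columns being numbered by enum_val. *)
Definition distmx : 'M[R]_#|V| :=
  \matrix_(i, j) (dist G (enum_val i) (enum_val j))%:R.

(* The action of D_G on C(V), without the numbering of V. *)
Definition dist_op (f : {ffun V -> R}) : {ffun V -> R} :=
  [ffun v => \sum_w (dist G v w)%:R * f w].

(* Indexed from 1: dist_eigenvalue 1 is the largest eigenvalue. *)
Definition dist_eigenvalue (k : nat) : R := (eigenvalues distmx)`_k.-1.

Definition QEC_admissible (f : {ffun V -> R}) : Prop :=
  inner f f = 1 /\ inner const1 f = 0.

Definition QEC : R :=
  sup [set inner f (dist_op f) | f in QEC_admissible]%classic.

Definition QEC_max_attained_at (f : {ffun V -> R}) : Prop :=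
  [/\ QEC_admissible f,
      QEC = inner f (dist_op f) &
      forall h, QEC_admissible h ->
        inner h (dist_op h) <= inner f (dist_op f)].

End DistanceMatrix.

Arguments distmx R {V} G.
Arguments dist_eigenvalue R {V} G k.
Arguments QEC R {V} G.

Section DoubleStar.
Local Open Scope nat_scope.

Definition is_center (n : nat) (i : 'I_n) : bool := val i == 0.

(* K_{1,n-1} on {0, ..., n-1}: an edge has exactly one end at the center 0. *)
Definition star_adj (n : nat) : rel 'I_n :=
  fun i j => is_center i (+) is_center j.

(* The first star occupies {0, ..., m-1}, with center 0, and the second one
   {m, ..., m+n-1}, with center m. *)
Definition double_star_adj (m n : nat) : rel 'I_(m + n) :=
  fun u v =>
    match split u, split v with
    | inl i, inl j => star_adj i j
    | inr i, inr j => star_adj i j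
    | inl i, inr j => is_center i && is_center j
    | inr i, inl j => is_center i && is_center j
    end.

Lemma double_star_sym m n : symmetric (@double_star_adj m n).
Proof.
move=> u v; rewrite /double_star_adj /star_adj.
by case: (split u) => i; case: (split v) => j; rewrite 1?addbC 1?andbC.
Qed.

Lemma double_star_irr m n : irreflexive (@double_star_adj m n).
Proof.
by move=> u; rewrite /double_star_adj /star_adj; case: (split u) => i; rewrite addbb.
Qed.

Lemma star_adj_center n (i c : 'I_n) :
  is_center c -> (i == c) || star_adj i c.
Proof.
rewrite /star_adj => cC; rewrite cC addbT; case: (boolP (is_center i)) => iC.
  by rewrite -val_eqE (eqP iC) (eqP cC).
by rewrite orbT.
Qed.

Lemma double_star_connected m n (u v : 'I_(m + n)) :
  connect (@double_star_adj m n) u v.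
Proof.
set e := @double_star_adj m n.
have eC : connect_sym e by apply/sym_connect_sym/double_star_sym.
have spl (x : 'I_m + 'I_n) : split (unsplit x) = x := unsplitK x.
have toL (i c : 'I_m) : is_center c -> connect e (lshift n i) (lshift n c).
  move=> /(star_adj_center i) /orP[/eqP->|ic]; first exact: connect0.
  by apply: connect1; rewrite /e /double_star_adj (spl (inl i)) (spl (inl c)).
have toR (i c : 'I_n) : is_center c -> connect e (rshift m i) (rshift m c).
  move=> /(star_adj_center i) /orP[/eqP->|ic]; first exact: connect0.
  by apply: connect1; rewrite /e /double_star_adj (spl (inr i)) (spl (inr c)).
have center k (i : 'I_k) : exists c : 'I_k, is_center c.
  by exists (Ordinal (leq_ltn_trans (leq0n i) (ltn_ord i))).
have LR (i : 'I_m) (j : 'I_n) : connect e (lshift n i) (rshift m j).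
  have [[c cC] [d dC]] := (center _ i, center _ j).
  apply: connect_trans (toL i c cC) _.
  apply: (@connect_trans _ _ (rshift m d)); last by rewrite eC toR.
  apply: connect1; rewrite /e /double_star_adj (spl (inl c)) (spl (inr d)).
  by rewrite cC dC.
rewrite -(splitK u) -(splitK v).
case: (split u) => i; case: (split v) => j /=.
- have [c cC] := center _ i.
  by apply: connect_trans (toL i c cC) _; rewrite eC toL.
- exact: LR.
- by rewrite eC LR.
- have [c cC] := center _ i.
  by apply: connect_trans (toR i c cC) _; rewrite eC toR.
Qed.

Definition double_star (m n : nat) : connected_graph 'I_(m + n) :=
  ConnectedGraph (@double_star_sym m n) (@double_star_irr m n)
                 (@double_star_connected m n).

End DoubleStar.

(* The concatenation of two vectors, the first one on top. *)
Definition stack (R : realType) (m n : nat)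
    (y : {ffun 'I_m -> R}) (z : {ffun 'I_n -> R}) : {ffun 'I_(m + n) -> R} :=
  [ffun k => match split k with inl i => y i | inr j => z j end].

(* Main.v *)
Require Import Defs.
From mathcomp Require Import all_boot all_order all_algebra.
From mathcomp Require Import classical_sets reals.
From mathcomp Require Import ring lra zify.

(** Let [n = k + 1], so that each of the two stars has [k] leaves, and let [lam]
    be the larger root of [X^2 + (k + 3) X + 2]; it is the value claimed, and
    [-1 < lam < 0]. The maximum and the second eigenvalue are both computed
    explicitly and found to be [lam]; no general comparison between the two is
    involved.

    Everything comes from the distances ([double_star_dist]): for [u != w] the
    distance counts 1 for each of [u] and [w] that is a leaf, and 1 more if
    they lie in different stars. Away from the diagonal, [D] is thus a sum of a
    few products of functions of [u] by functions of [w].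

    The constant. If [h] sums to 0, the formula gives
    [<h, D h> = - 2 L^2 - 2 P], where [L] is the sum of [h] over the first star
    and [P] the sum of the squares of [h] at the leaves ([double_star_form]).
    Since the sum over the second star is [- L], the inequality
    [<h, D h> <= lam <h, h>] splits into one inequality for each star, which is
    a sum of squares precisely because [lam] is a root of the quadratic above
    ([star_form_bound]). The vector [g] gives equality.

    The eigenvalue. [D + 2 I] is constant on pairs of classes, the four classes
    being the two centers and the two sets of leaves, hence [D + 2 I = A B] with
    inner dimension 4, and Sylvester's identity ([det_scalar_sub_mulmx]) reduces
    the characteristic polynomial of [D] to that of the 4 x 4 matrix [B A].
    Splitting functions into those that are even and those that are odd under
    the exchange of the two stars makes [B A] block diagonal, so that the
    polynomial is
    [(X + 2)^(2k - 2) (X^2 - (5k - 1) X - (4k + 2)) (X^2 + (k + 3) X + 2)]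
    ([char_poly_double_star]). The even factor has one root above [lam] and one
    below, and all the other roots are at most [lam], so [lam] comes second
    ([dist_eigenvalue2_double_star]). *)

Set Implicit Arguments.
Unset Strict Implicit.
Unset Printing Implicit Defensive.
Import Order.TTheory GRing.Theory Num.Theory.
Local Open Scope ring_scope.

(** * Distances in a graph *)

Section GraphDistance.
Local Open Scope nat_scope.
Variables (V : finType) (G : connected_graph V).

Lemma dist_path (v w : V) :
  exists p, [/\ path (adj G) v p, last v p = w & size p = dist G v w].
Proof.
rewrite /dist; case: ex_minnP => k /existsP[p /and3P[pP _ /eqP pw]] _.
by exists p; rewrite size_tuple.
Qed.

(** Removing the loops of a walk leaves a simple path on some of its vertices,
    and [dist] is the least length of a simple path. *)
Lemma dist_le_size (v : V) p :
  path (adj G) v p -> dist G v (last v p) <= size p.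
Proof.
move=> pP; case/shortenP: pP => q qP uq /uniq_leq_size qp.
apply: leq_trans (qp (subseq_uniq (subseq_cons q v) uq)).
rewrite /dist; case: ex_minnP => k _; apply.
by apply/existsP; exists (in_tuple q); rewrite qP uq eqxx.
Qed.

(** A guess [h] for the distance to [w] can be checked locally: along any path
    to [w] it drops by at most 1 at each step, so it bounds the distance from
    below, and following steps where it drops by exactly 1 reaches [w] in [h u]
    steps, so it bounds the distance from above. *)
Lemma dist_eq_potential (w : V) (h : V -> nat) :
  h w = 0 -> (forall u v, adj G u v -> h u <= (h v).+1) ->
  (forall u, u != w -> exists2 v, adj G u v & h u = (h v).+1) ->
  forall u, dist G u w = h u.
Proof.
move=> hw lip desc u; apply/eqP; rewrite eqn_leq; apply/andP; split.
  have [p [pP <- <-]] : exists p,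
      [/\ path (adj G) u p, last u p = w & size p = h u].
    elim: {u}(h u) {-2}u (erefl (h u)) => [|k IHk] u hu.
      case: (eqVneq u w) => [->|/desc[v _]]; last by rewrite hu.
      by exists [::].
    case: (eqVneq u w) hu => [->|/desc[v uv ->] [hv]]; first by rewrite hw.
    by have [p [pP pw pk]] := IHk v hv; exists (v :: p); rewrite /= uv pP pk.
  exact: dist_le_size.
have [p [pP pw <-]] := dist_path u w.
elim: p u pP pw => [|v p IHp] u /=; first by move=> _ ->; rewrite hw.
by move=> /andP[uv pP] pw; apply: leq_trans (lip _ _ uv) _; rewrite ltnS IHp.
Qed.

End GraphDistance.

(** * Distances in a double star *)

Section DoubleStarDistance.
Variables m n : nat.
Implicit Types u v w : 'I_(m + n).

Definition in_first_star u : bool := if split u is inl _ then true else false.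

Definition at_center u : bool :=
  match split u with inl i => is_center i | inr j => is_center j end.

Notation l := in_first_star.
Notation c := at_center.

(** Adjacency depends on these two booleans only, so that the local conditions
    on a guess for the distance reduce to finitely many cases. *)
Lemma double_star_adjE u v :
  adj (double_star m n) u v =
  if l u == l v then c u (+) c v else c u && c v.
Proof.
rewrite /= /double_star_adj /star_adj /in_first_star /at_center.
by case: (split u) => i; case: (split v) => j.
Qed.

Lemma center_inj u v : c u -> c v -> l u = l v -> u = v.
Proof.
rewrite /in_first_star /at_center -{3}(splitK u) -{3}(splitK v) /is_center.
case: (split u) => i; case: (split v) => j /= /eqP i0 /eqP j0 // _;
  by have -> : i = j by apply: val_inj; rewrite /= i0 j0.
Qed.

Lemma star_center_ex u : exists2 v, l v = l u & c v.
Proof.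
have ctr k (i : 'I_k) : exists j : 'I_k, is_center j.
  by exists (Ordinal (leq_ltn_trans (leq0n i) (ltn_ord i))).
rewrite /in_first_star /at_center.
case: (split u) => i; have [j jC] := ctr _ i.
  by exists (lshift n j); rewrite (unsplitK (inl j)).
by exists (rshift m j); rewrite (unsplitK (inr j)).
Qed.

(** From a leaf a shortest path first moves to the center of its star, and from
    a center to the target if it is in the same star, to the other center if it
    is not; the formula satisfies the local conditions of
    [dist_eq_potential]. *)
Lemma double_star_dist u w :
  dist (double_star m n) u w =
  if u == w then 0%N else (~~ c u + ~~ c w + (l u != l w))%N.
Proof.
move: u; apply: dist_eq_potential => [|u v|u uw]; first by rewrite eqxx.
  rewrite double_star_adjE; case: (eqVneq u w) => // uw.
  case: (eqVneq v w) => [->|_].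
    by case: (l u) (l w) (c u) (c w) => [] [] [] [].
  by case: (l u) (l v) (l w) (c u) (c v) (c w) => [] [] [] [] [] [].
rewrite (negPf uw); case: (boolP (c u)) => cu.
  case: (eqVneq (l u) (l w)) => lu.
    have /negPf cw : ~~ c w.
      by apply: contra uw => cw; rewrite (center_inj cu cw).
    by exists w; rewrite ?double_star_adjE ?lu ?eqxx ?cu ?cw.
  have [v lv cv] := star_center_ex w.
  exists v; first by rewrite double_star_adjE lv (negPf lu) cu cv.
  by case: (eqVneq v w) => [<-|_]; rewrite ?cv ?lv ?eqxx ?addn0 ?addn1.
have [v lv cv] := star_center_ex u.
exists v; first by rewrite double_star_adjE lv eqxx cv (negPf cu).
by case: (eqVneq v w) => [<-|_]; rewrite ?cv lv ?eqxx.
Qed.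

End DoubleStarDistance.

Lemma big_double_star (U : zmodType) (m n : nat) (F : 'I_(m.+1 + n.+1) -> U) :
  \sum_v F v =
  F (lshift _ ord0) + \sum_(i < m) F (lshift _ (lift ord0 i)) +
  (F (rshift _ ord0) + \sum_(j < n) F (rshift _ (lift ord0 j))).
Proof. by rewrite big_split_ord /= !big_ord_recl. Qed.

Lemma vertex_kind_lshift (m n : nat) (i : 'I_m) :
  (in_first_star (lshift n i) = true) * (at_center (lshift n i) = is_center i).
Proof. by rewrite /in_first_star /at_center (unsplitK (inl i)). Qed.

Lemma vertex_kind_rshift (m n : nat) (j : 'I_n) :
  (in_first_star (rshift m j) = false) * (at_center (rshift m j) = is_center j).
Proof. by rewrite /in_first_star /at_center (unsplitK (inr j)). Qed.

Lemma sum_double_star (U : zmodType) (m n : nat) (F : bool -> bool -> U) :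
  \sum_(v : 'I_(m.+1 + n.+1)) F (in_first_star v) (at_center v) =
  F true true + F true false *+ m + (F false true + F false false *+ n).
Proof.
rewrite big_double_star !(vertex_kind_lshift, vertex_kind_rshift).
congr (_ + _ + (_ + _)).
  rewrite -[m in RHS]card_ord -sumr_const; apply: eq_bigr => i _.
  by rewrite !vertex_kind_lshift.
rewrite -[n in RHS]card_ord -sumr_const; apply: eq_bigr => j _.
by rewrite !vertex_kind_rshift.
Qed.

(** * Determinants and eigenvalue lists *)

(** Sylvester's identity. Both sides are the determinant of the block matrix
    [[x I, A], [B, I]], computed after clearing its lower left block in two
    ways: by column operations, which leave [x I - A B] and [I] on the diagonal,
    and by row operations scaled by [x], which leave [x I] and [x I - B A]. *)
Lemma det_scalar_sub_mulmx (R : comNzRingType) (p q : nat) (x : R)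
    (A : 'M[R]_(p, q)) (B : 'M[R]_(q, p)) :
  x ^+ q * \det (x%:M - A *m B) = x ^+ p * \det (x%:M - B *m A).
Proof.
have -> : \det (x%:M - A *m B) = \det (block_mx x%:M A B 1%:M).
  have detT : \det (block_mx 1%:M 0 (- B) (1%:M : 'M_q)) = 1.
    by rewrite det_lblock !det1 mulr1.
  rewrite -[RHS]mulr1 -[X in _ = _ * X]detT -det_mulmx mulmx_block.
  rewrite !mulmx0 !mulmx1 !mul1mx !add0r mulmxN addrN det_ublock det1.
  by rewrite mulr1.
have -> : x ^+ q = \det (block_mx 1%:M 0 (- B) (x%:M : 'M_q)).
  by rewrite det_lblock det1 mul1r det_scalar.
rewrite -det_mulmx mulmx_block !mul0mx !mul1mx !addr0 mulmx1 mulNmx.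
rewrite mul_mx_scalar mul_scalar_mx addNr det_ublock det_scalar mulNmx.
by rewrite addrC.
Qed.

Lemma det_mx22 (R : comNzRingType) (M : 'M[R]_2) :
  \det M = M 0 0 * M 1 1 - M 0 1 * M 1 0.
Proof.
rewrite (expand_det_row _ 0) !big_ord_recl big_ord0 /cofactor !det_mx11 !mxE /=.
rewrite addr0 expr0 expr1 mul1r mulN1r mulrN.
congr (_ * M _ _ - M _ _ * M _ _); exact: val_inj.
Qed.

(** A split characteristic polynomial determines its roots up to order, and
    sorting fixes the order. *)
Lemma eigenvalues_eq (R : realType) (n : nat) (A : 'M[R]_n) (s : seq R) :
  sorted >=%R s -> char_poly A = \prod_(x <- s) ('X - x%:P) ->
  eigenvalues A = s.
Proof.
move=> s_sorted As; apply: xget_unique => // t [t_sorted At].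
apply: (@sorted_eq _ (>=%R : rel R)) => //.
- exact: rev_trans le_trans.
- by move=> x y /andP[yx xy]; apply/le_anti/andP.
by apply: prod_XsubC_eq; rewrite -As -At.
Qed.

Lemma second_eigenvalue (R : realType) (n : nat) (A : 'M[R]_n) (a b : R) s :
  char_poly A = ('X - a%:P) * ('X - b%:P) * \prod_(x <- s) ('X - x%:P) ->
  b <= a -> all (<= b) s -> (eigenvalues A)`_1 = b.
Proof.
move=> As ba /allP sb; set t := a :: b :: sort >=%R s.
have t_sorted : sorted >=%R t.
  rewrite /= ba /= path_sortedE; last exact: rev_trans le_trans.
  apply/andP; split; last exact/sort_sorted/ge_total.
  by apply/allP => x; rewrite mem_sort => /sb.
rewrite (eigenvalues_eq t_sorted) // As !big_cons mulrA; congr (_ * _).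
by apply: perm_big; rewrite perm_sym perm_sort.
Qed.

(** * The characteristic polynomial of the distance matrix *)

Section Spectrum.
Variables (R : realType) (k : nat).

Notation V := 'I_(k.+1 + k.+1).
Notation D := (distmx R (double_star k.+1 k.+1)).

(** The indicator of the centers for [i = 0], of the leaves for [i = 1]. *)
Definition cell (u : V) (i : 'I_2) : R := ((i == 0) == at_center u)%:R.

Definition side (u : V) : R := if in_first_star u then 1 else -1.

(** The columns of [even_left] and [odd_left] span the functions that are
    constant on the four classes of vertices, the even and the odd ones under
    the exchange of the two stars. The columns of [even_right] and [odd_right]
    are the coordinates, on these, of the columns of [D + 2 I]. *)
Definition even_left : 'M[R]_(#|V|, 2) :=
  \matrix_(p, i) cell (enum_val p) i.

Definition odd_left : 'M[R]_(#|V|, 2) :=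
  \matrix_(p, i) (side (enum_val p) * cell (enum_val p) i).

Definition even_right : 'M[R]_(2, #|V|) :=
  \matrix_(i, p)
    (if i == 0 then 3 / 2 else 5 / 2 - (at_center (enum_val p))%:R).

Definition odd_right : 'M[R]_(2, #|V|) :=
  \matrix_(i, p) (side (enum_val p) *
                  ((i == 0)%:R * (at_center (enum_val p))%:R - 1 / 2)).

(** The shift by 2 is what makes the diagonal fit: two distinct leaves of the
    same star are at distance 2, so adding 2 on the diagonal makes the matrix
    constant on pairs of classes. *)
Lemma distmx_shift_factor :
  D + 2%:M = even_left *m even_right + odd_left *m odd_right.
Proof.
apply/matrixP => p q; rewrite !mxE !big_ord_recl !big_ord0 !mxE /cell /side /=.
rewrite -(inj_eq (@enum_val_inj _ (mem V)) p q).
move: (enum_val p) (enum_val q) => u v {p q}.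
rewrite double_star_dist; case: (eqVneq u v) => [->|uv].
  by case: (at_center v) (in_first_star v) => [] []; rewrite /= ?mulr1n; lra.
have := @center_inj _ _ u v; move: uv => /eqP.
case: (at_center u) (at_center v) (in_first_star u) (in_first_star v)
  => [] [] [] [] //= uv uvP; rewrite ?mulr1n ?mulr0n /=; try lra;
by case: uv; apply: uvP.
Qed.

Lemma sum_enum_val (F : bool -> bool -> R) :
  \sum_(p < #|V|) F (in_first_star (enum_val p)) (at_center (enum_val p)) =
  F true true + k%:R * F true false + (F false true + k%:R * F false false).
Proof.
rewrite !mulr_natl -(sum_double_star k k F).
pose Fv (v : V) := F (in_first_star v) (at_center v).
by rewrite -(big_enum_val (A := V) Fv).
Qed.

(** The two diagonal blocks of [B A]; the factors 1 and [k] are the numbers of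
    centers and of leaves of a star. *)
Lemma even_gram :
  even_right *m even_left = \matrix_(i, j)
  ((if i == 0 then 3 else if j == 0 then 3 else 5) *
   (if j == 0 then 1 else k%:R)).
Proof.
apply/matrixP => i j; rewrite !mxE.
under eq_bigr do rewrite !mxE /cell.
rewrite (sum_enum_val (fun (_ c : bool) =>
   (if i == 0 then 3 / 2 else 5 / 2 - c%:R) *
   ((j == 0) == c)%:R)).
by case: (i == 0) (j == 0) => [] [] /=; lra.
Qed.

Lemma odd_gram :
  odd_right *m odd_left = \matrix_(i, j)
  ((if (i == 0) && (j == 0) then 1 else -1) * (if j == 0 then 1 else k%:R)).
Proof.
apply/matrixP => i j; rewrite !mxE.
under eq_bigr do rewrite !mxE /cell /side.
rewrite (sum_enum_val (fun (l c : bool) =>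
   (if l then 1 else -1) *
   ((i == 0)%:R * c%:R - 1 / 2) *
   ((if l then 1 else -1) * ((j == 0) == c)%:R))).
by case: (i == 0) (j == 0) => [] [] /=; lra.
Qed.

Lemma even_odd_orthogonal : even_right *m odd_left = 0.
Proof.
apply/matrixP => i j; rewrite !mxE.
under eq_bigr do rewrite !mxE /cell /side.
rewrite (sum_enum_val (fun (l c : bool) =>
   (if i == 0 then 3 / 2 else 5 / 2 - c%:R) *
   ((if l then 1 else -1) * ((j == 0) == c)%:R))).
by case: (i == 0) (j == 0) => [] [] /=; lra.
Qed.

Lemma odd_even_orthogonal : odd_right *m even_left = 0.
Proof.
apply/matrixP => i j; rewrite !mxE.
under eq_bigr do rewrite !mxE /cell /side.
rewrite (sum_enum_val (fun (l c : bool) =>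
   (if l then 1 else -1) *
   ((i == 0)%:R * c%:R - 1 / 2) * ((j == 0) == c)%:R)).
by case: (i == 0) (j == 0) => [] [] /=; lra.
Qed.

(** The substitution [X + 2] undoes the shift of [distmx_shift_factor]; the
    power on the left is the one that Sylvester's identity leaves on the larger
    matrix. The exponent [2 + 2] is the width of the factorization as the block
    matrices record it. *)
Lemma char_poly_double_star :
  ('X + 2%:P) ^+ (2 + 2) * char_poly D =
  ('X + 2%:P) ^+ #|V| *
  (('X ^+ 2 - (5 * k%:R - 1)%:P * 'X - (4 * k%:R + 2)%:P) *
   ('X ^+ 2 + (k%:R + 3)%:P * 'X + 2%:P)) :> {poly R}.
Proof.
set A := row_mx even_left odd_left.
set B := col_mx even_right odd_right.
have -> : char_poly D =
    \det (('X + 2%:P)%:M - map_mx polyC A *m map_mx polyC B).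
  rewrite /char_poly -map_mxM mul_row_col -distmx_shift_factor /char_poly_mx.
  by rewrite map_mxD map_scalar_mx /= raddfD /= opprD addrACA addrN addr0.
rewrite det_scalar_sub_mulmx; congr (_ * _).
have BA : B *m A = block_mx (even_right *m even_left) 0 0
                            (odd_right *m odd_left).
  by rewrite /A /B mul_col_row even_odd_orthogonal odd_even_orthogonal.
rewrite -map_mxM BA even_gram odd_gram map_block_mx !map_mx0.
rewrite scalar_mx_block opp_block_mx add_block_mx.
rewrite !oppr0 !addr0 det_ublock !det_mx22.
rewrite !mxE /= !mulr1n !mulr0n !(polyCD, polyCB, polyCM).
ring.
Qed.

End Spectrum.

(** The roots besides [lam] are [a > lam] and, below [lam], the other root of
    each quadratic factor and -2. The condition [-1 < lam] selects the larger
    root of [X^2 + (k + 3) X + 2], as the two roots have product 2 and sum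
    [- (k + 3)]. *)
Lemma dist_eigenvalue2_double_star (R : realType) (k : nat) (lam : R) :
  (0 < k)%N -> lam ^+ 2 + (k%:R + 3) * lam + 2 = 0 -> -1 < lam ->
  dist_eigenvalue R (double_star k.+1 k.+1) 2 = lam.
Proof.
move=> k_gt0 lam_root lam_gt; set t : R := k%:R in lam_root.
have t_ge1 : 1 <= t by rewrite ler1n.
have lam_lt0 : lam < 0 by nra.
(* On [-1, -2/3[ the quadratic is negative; -2/3 is what places [lam] above
   the smaller root of the even factor. *)
have lam_ge : - (2 / 3) <= lam.
  by rewrite leNgt; apply/negP => lam_lt; nra.
(* [a] and [b] are the roots of the even factor. *)
pose s := Num.sqrt ((5 * t - 1) ^+ 2 + 4 * (4 * t + 2)).
have s2 : s ^+ 2 = (5 * t - 1) ^+ 2 + 4 * (4 * t + 2).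
  by rewrite sqr_sqrtr //; nra.
have s_ge0 : 0 <= s by apply: sqrtr_ge0.
pose a := (5 * t - 1 + s) / 2; pose b := (5 * t - 1 - s) / 2.
have ab : a + b = 5 * t - 1 by rewrite /a /b; field.
have abM : a * b = - (4 * t + 2).
  have -> : a * b = ((5 * t - 1) ^+ 2 - s ^+ 2) / 4 by rewrite /a /b; field.
  by rewrite s2; field.
have lam_a : lam <= a by rewrite /a; lra.
have b_lam : b <= lam.
  (* The even factor is nonpositive at [lam]. *)
  have [lam_eq|lam_neq] := eqVneq lam a; first by rewrite lam_eq /a /b; lra.
  have lam_lta : lam < a by rewrite lt_neqAle lam_neq.
  have : (lam - a) * (lam - b) <= 0.
    have -> : (lam - a) * (lam - b) = lam ^+ 2 - (a + b) * lam + a * b by ring.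
    by rewrite ab abM; nra.
  by rewrite nmulr_rle0 ?subr_lt0 // subr_ge0.
apply: (@second_eigenvalue _ _ _ a lam
          (b :: - (t + 3) - lam :: nseq (2 * k - 2) (-2))) => //; last first.
  rewrite /= b_lam /=; apply/andP; split; first by lra.
  by apply/allP => x /nseqP[-> _] /=; lra.
have X2 : 'X + 2%:P != 0 :> {poly R}.
  by rewrite -[2%:P]opprK -polyCN polyXsubC_eq0.
apply: (mulfI (expf_neq0 (2 + 2) X2)); rewrite char_poly_double_star.
have -> : #|'I_(k.+1 + k.+1)| = (2 + 2 + (2 * k - 2))%N.
  by rewrite card_ord -(prednK k_gt0); lia.
rewrite exprD -mulrA; congr (_ * _).
rewrite !big_cons big_nseq.
have -> : iter (2 * k - 2) (GRing.mul ('X - (-2)%:P)) 1 =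
          ('X + 2%:P) ^+ (2 * k - 2) :> {poly R}.
  by rewrite iter_mulr_1 polyCN opprK.
rewrite -/t -ab -[4 * t + 2]opprK -abM polyCN opprK.
(* Eliminating the constant term 2 by [lam_root] leaves an identity in [lam]. *)
have -> : 2%:P = - (lam ^+ 2 + (t + 3) * lam)%:P :> {poly R}.
  by rewrite -polyCN; congr (_%:P); lra.
rewrite !(polyCD, polyCB, polyCM, polyCN, rmorphXn) /=; ring.
Qed.

(** * The quadratic embedding constant of a double star *)

(** The supremum of the Rayleigh quotient on the functions of sum 0 is attained
    at [g], normalized, as soon as [g] reaches an upper bound of it. *)
Lemma QEC_max_attained_rayleigh (R : realType) (V : finType)
    (G : connected_graph V) (g : {ffun V -> R}) (lam : R) :
  inner const1 g = 0 -> 0 < inner g g ->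
  inner g (dist_op G g) = lam * inner g g ->
  (forall h, inner const1 h = 0 ->
     inner h (dist_op G h) <= lam * inner h h) ->
  QEC R G = lam /\ QEC_max_attained_at G [ffun v => g v / norm2 g].
Proof.
move=> g_e g_gt0 Dg Dle; set f := [ffun v => _].
have N2 : norm2 g ^+ 2 = inner g g by rewrite sqr_sqrtr // ltW.
have N0 : norm2 g != 0 by rewrite gt_eqF // sqrtr_gt0.
have f_adm : QEC_admissible f.
  split.
    rewrite -(@mulfV _ (norm2 g ^+ 2)) ?expf_neq0 // {1}N2 /inner mulr_suml.
    by apply: eq_bigr => v _; rewrite !ffunE; field.
  rewrite -(mul0r (norm2 g)^-1) -g_e /inner mulr_suml.
  by apply: eq_bigr => v _; rewrite !ffunE mulrA.
have Df : inner f (dist_op G f) = lam.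
  have -> : inner f (dist_op G f) = inner g (dist_op G g) / norm2 g ^+ 2.
    rewrite /inner mulr_suml; apply: eq_bigr => v _; rewrite !ffunE.
    have -> : \sum_w (dist G v w)%:R * f w =
              (\sum_w (dist G v w)%:R * g w) / norm2 g.
      by rewrite mulr_suml; apply: eq_bigr => w _; rewrite ffunE mulrA.
    by field.
  by rewrite Dg -N2 mulfK // expf_neq0.
have f_max h : QEC_admissible h -> inner h (dist_op G h) <= lam.
  by move=> [h1 he]; rewrite -[lam]mulr1 -h1; apply: Dle.
have QECf : QEC R G = lam.
  apply/le_anti/andP; split.
    apply: ge_sup; first by exists lam, f.
    by move=> _ [h h_adm <-]; apply: f_max.
  apply: ub_le_sup; last by exists f.
  by exists lam => _ [h h_adm <-]; apply: f_max.
split=> //; split=> [//||h h_adm]; rewrite ?QECf Df //; exact: f_max.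
Qed.

Section QuadraticForm.
Variables (R : realType) (m n : nat).
Implicit Type h : {ffun 'I_(m + n) -> R}.

(** The distance between two vertices of a tree is the number of edges that
    separate them, so [<h, D h>] is the sum over the edges of twice the product
    of the sums of [h] on the two sides, that is, of minus twice the square of
    one of them when [h] sums to 0. The middle edge gives the first term, the
    edge at each leaf the other ones. *)
Lemma double_star_form h : inner const1 h = 0 ->
  inner h (dist_op (double_star m n) h) =
  - 2 * (\sum_v (in_first_star v)%:R * h v) ^+ 2
  - 2 * \sum_v (~~ at_center v)%:R * h v ^+ 2.
Proof.
rewrite /inner; under eq_bigr do rewrite ffunE mul1r.
move=> h0; set L := \sum_v (in_first_star v)%:R * _.
set P := \sum_v _ * _ ^+ 2; set C := \sum_v (~~ at_center v)%:R * h v.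
transitivity (\sum_v h v * (C + L) - 2 * (L * \sum_v (in_first_star v)%:R * h v)
  - 2 * P); last by rewrite -mulr_suml h0 -/L; ring.
rewrite !mulr_sumr -!sumrB; apply: eq_bigr => u _; rewrite ffunE.
have -> : \sum_w (dist (double_star m n) u w)%:R * h w =
    (~~ at_center u)%:R * \sum_w h w + C + (in_first_star u)%:R * \sum_w h w + L
    - 2 * (in_first_star u)%:R * L
    - 2 * (~~ at_center u)%:R * \sum_w (u == w)%:R * h w.
  (* Summand by summand; the last term cancels the two leaf contributions that
     the formula for distinct vertices would give at [u = w]. *)
  rewrite !mulr_sumr -!(big_split, sumrB) /=; apply: eq_bigr => w _.
  rewrite double_star_dist; case: eqVneq => [<-|_].
    by case: (at_center u) (in_first_star u) => [] []; rewrite /=; lra.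
  by case: (at_center u) (at_center w) (in_first_star u) (in_first_star w)
    => [] [] [] []; rewrite /=; lra.
rewrite h0 (bigD1 u) //= eqxx big1 => [|w /negPf]; last first.
  by rewrite eq_sym => ->; rewrite mul0r.
rewrite /=; ring.
Qed.

End QuadraticForm.

Lemma double_star_form_coord (R : realType) (m n : nat)
    (h : {ffun 'I_(m.+1 + n.+1) -> R}) :
  let a := h (lshift _ ord0) in let x i := h (lshift _ (lift ord0 i)) in
  let b := h (rshift _ ord0) in let z j := h (rshift _ (lift ord0 j)) in
  inner const1 h = 0 ->
  inner h (dist_op (double_star m.+1 n.+1) h) =
  - 2 * (a + \sum_i x i) ^+ 2 - 2 * (\sum_i x i ^+ 2 + \sum_j z j ^+ 2).
Proof.
move=> a x b z /double_star_form ->; rewrite !big_double_star.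
rewrite !(vertex_kind_lshift, vertex_kind_rshift) /= !mul0r !add0r mul1r.
congr (- 2 * _ ^+ 2 - 2 * (_ + _)).
- rewrite [X in _ + X]big1 ?addr0 => [|j _].
    by congr (_ + _); apply: eq_bigr => i _; rewrite vertex_kind_lshift mul1r.
  by rewrite vertex_kind_rshift mul0r.
- by apply: eq_bigr => i _; rewrite vertex_kind_lshift mul1r.
- by apply: eq_bigr => j _; rewrite vertex_kind_rshift mul1r.
Qed.

Lemma sum_sqr_le (R : realType) (k : nat) (x : 'I_k -> R) :
  (\sum_i x i) ^+ 2 <= k%:R * \sum_i x i ^+ 2.
Proof.
case: k x => [|k] x; first by rewrite !big_ord0 mul0r expr0n.
set X := \sum_i x i; set P := \sum_i _; set t : R := k.+1%:R.
have t_gt0 : 0 < t by rewrite ltr0n.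
(* The variance of the [x i], up to scaling. *)
rewrite -subr_ge0 -(pmulr_rge0 _ t_gt0).
have -> : t * (t * P - X ^+ 2) = \sum_i (t * x i - X) ^+ 2.
  transitivity (\sum_i (t ^+ 2 * x i ^+ 2 - 2 * t * X * x i + X ^+ 2)).
    rewrite big_split sumr_const card_ord sumrB -!mulr_sumr -/X -/P /=.
    by rewrite -[X ^+ 2 *+ _]mulr_natl -/t; ring.
  by apply: eq_bigr => i _; ring.
by apply: sumr_ge0 => i _; apply: sqr_ge0.
Qed.

(** The contribution of one star with value [a] at the center and [x] at the
    leaves. With [t = k], [P] the sum of the [x i ^+ 2] and [X] that of the
    [x i], the difference [Q] of the two sides satisfies
    [t (1 + lam) Q = t ((1 + lam) a + X)^2 + (1 + lam) (2 + lam) (t P - X^2)]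
    modulo the equation of [lam], and [X^2 <= t P] by Cauchy-Schwarz. *)
Lemma star_form_bound (R : realType) (k : nat) (lam a : R) (x : 'I_k -> R) :
  (0 < k)%N -> lam ^+ 2 + (k%:R + 3) * lam + 2 = 0 -> -1 < lam ->
  - 2 * (\sum_i x i ^+ 2) - (a + \sum_i x i) ^+ 2 <=
  lam * (a ^+ 2 + \sum_i x i ^+ 2).
Proof.
move=> k_gt0 lam_root lam_gt; have := sum_sqr_le x.
set X := \sum_i x i; set P := \sum_i _; set t : R := k%:R in lam_root * => XP.
have t_gt0 : 0 < t by rewrite ltr0n.
rewrite -subr_ge0; set Q := _ - _.
have : 0 <= t * (1 + lam) * Q.
  have -> : t * (1 + lam) * Q =
      t * ((1 + lam) * a + X) ^+ 2 + (1 + lam) * (2 + lam) * (t * P - X ^+ 2)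
      + (lam ^+ 2 + (t + 3) * lam + 2) * X ^+ 2.
    by rewrite /Q; ring.
  rewrite lam_root mul0r addr0; apply: addr_ge0.
    by rewrite mulr_ge0 ?sqr_ge0 // ltW.
  by rewrite !mulr_ge0 ?subr_ge0 //; lra.
by rewrite pmulr_rge0 // mulr_gt0 //; lra.
Qed.

Theorem theorem1p6 (R : realType) (n : nat) (hn : (2 <= n)%N) :
  let S := double_star n n in
  let r : R := Num.sqrt ((n%:R + 2) ^+ 2 - 8) in
  let y : {ffun 'I_n -> R} :=
    [ffun i : 'I_n => if val i == 0%N then (n%:R + r) / 2 else -1] in
  let g := stack y (- y) in
  let f : {ffun 'I_(n + n) -> R} := [ffun v => g v / norm2 g] in
  [/\ QEC R S = dist_eigenvalue R S 2,
      dist_eigenvalue R S 2 = (- (n%:R + 2) + r) / 2 &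
      QEC_max_attained_at S f].
Proof.
case: n hn => [//|k]; rewrite ltnS => k_gt0 S r y g f.
pose t : R := k%:R; have nE : k.+1%:R = t + 1 by rewrite -natr1.
have t_ge1 : 1 <= t by rewrite ler1n.
have r2 : r ^+ 2 = (t + 3) ^+ 2 - 8.
  by rewrite sqr_sqrtr nE; [ring | nra].
have r_gt : t + 1 < r.
  have r_ge0 : 0 <= r by apply: sqrtr_ge0.
  by nra.
set lam := (_ + r) / 2.
have lamE : r = 2 * lam + t + 3 by rewrite /lam nE; field.
have lam_root : lam ^+ 2 + (t + 3) * lam + 2 = 0.
  have -> : lam = (r - (t + 3)) / 2 by rewrite lamE; field.
  transitivity ((r ^+ 2 - (t + 3) ^+ 2 + 8) / 4); first by field.
  by rewrite r2; field.
have lam_gt : -1 < lam by lra.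
have eig2 := dist_eigenvalue2_double_star k_gt0 lam_root lam_gt.
have gl0 : g (lshift _ ord0) = lam + t + 2.
  by rewrite !ffunE (unsplitK (inl _)) ffunE /= nE lamE; field.
have glS i : g (lshift _ (lift ord0 i)) = -1.
  by rewrite !ffunE (unsplitK (inl _)) ffunE.
have gr0 : g (rshift _ ord0) = - (lam + t + 2).
  by rewrite !ffunE (unsplitK (inr _)) !ffunE /= nE lamE; field.
have grS j : g (rshift _ (lift ord0 j)) = 1.
  by rewrite !ffunE (unsplitK (inr _)) !ffunE /= opprK.
have sum_gl F : \sum_(i < k) F (g (lshift _ (lift ord0 i))) = t * F (-1) :> R.
  under eq_bigr do rewrite glS.
  by rewrite sumr_const card_ord mulr_natl.
have sum_gr F : \sum_(i < k) F (g (rshift _ (lift ord0 i))) = t * F 1 :> R.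
  under eq_bigr do rewrite grS.
  by rewrite sumr_const card_ord mulr_natl.
have g_e : inner const1 g = 0.
  rewrite /inner; under eq_bigr do rewrite ffunE mul1r.
  by rewrite big_double_star gl0 gr0 (sum_gl id) (sum_gr id); ring.
have gg : inner g g = 2 * ((lam + t + 2) ^+ 2 + t).
  rewrite /inner big_double_star gl0 gr0.
  by rewrite (sum_gl (fun c => c * c)) (sum_gr (fun c => c * c)); ring.
have Dg : inner g (dist_op S g) = lam * inner g g.
  rewrite gg double_star_form_coord // gl0 (sum_gl id).
  rewrite (sum_gl (fun c => c ^+ 2)) (sum_gr (fun c => c ^+ 2)).
  apply/eqP; rewrite -subr_eq0; apply/eqP.
  (* The defect of equality is a multiple of the equation of [lam]. *)
  transitivity (- 2 * (lam + t + 2) * (lam ^+ 2 + (t + 3) * lam + 2)).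
    by ring.
  by rewrite lam_root mulr0.
have Dle h : inner const1 h = 0 -> inner h (dist_op S h) <= lam * inner h h.
  move=> h_e; rewrite double_star_form_coord //; move: h_e.
  rewrite /inner; under eq_bigr do rewrite ffunE mul1r.
  rewrite !big_double_star => h_e.
  have := star_form_bound (h (lshift _ ord0))
    (fun i => h (lshift _ (lift ord0 i))) k_gt0 lam_root lam_gt.
  have := star_form_bound (h (rshift _ ord0))
    (fun i => h (rshift _ (lift ord0 i))) k_gt0 lam_root lam_gt.
  under [X in _ -> _ -> _ <= _ * (_ + X + _)]eq_bigr do rewrite -expr2.
  under [X in _ -> _ -> _ <= _ * (_ + (_ + X))]eq_bigr do rewrite -expr2.
  set X := \sum_i _ in h_e *; set Z := \sum_i _ in h_e *.
  (* The two stars have opposite sums, so their bounds add up to the claim. *)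
  have -> : h (rshift _ ord0) + Z = - (h (lshift _ ord0) + X) by lra.
  rewrite sqrrN; lra.
have gg_gt0 : 0 < inner g g by rewrite gg; nra.
have [QEClam attained] := QEC_max_attained_rayleigh g_e gg_gt0 Dg Dle.
by split=> //; rewrite QEClam eig2.
Qed.
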